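(* Let $K$ be a field, $J$ an ideal in $K[x]=K[x_1,\ldots,x_n]$, $R=K[x]/J$, $I$ an ideal of $R$ (given by finitely many generators), and $r\in\{1,\ldots,n\}$. Let $\hat S:=K[x_1+J,\ldots,x_r+J]\subseteq R$ be the $K$-subalgebra generated by the residue classes of $x_1,\ldots,x_r$ and let $S:=\hat S\setminus\{0\}$. Consider the following algorithm: (1) let $\varphi:K[t_1,\ldots,t_r]\to R$ be the $K$-algebra homomorphism with $t_i\mapsto x_i+J$; (2) compute generators $w_1,\ldots,w_m$ of the ideal $\varphi^{-1}(I)$ of $K[t_1,\ldots,t_r]$; (3) if there is an $i\in\{1,\ldots,m\}$ with $\varphi(w_i)\neq 0$, return $\varphi(w_i)$ for the first such $i$; otherwise return $0$. This algorithm terminates and is correct, i.e. it returns an element of $I\cap S$ if $I\cap S\neq\emptyset$, and returns $0$ if $I\cap S=\emptyset$.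
   Context: Preimages of ideals under homomorphisms of finitely presented commutative $K$-algebras are computed by the standard (terminating) Gröbner basis elimination procedure. *)

(* Defs.v *)
From HB Require Import structures.
From mathcomp Require Import all_boot all_order all_algebra.
From mathcomp Require Import ring_quotient.
From mathcomp.multinomials Require Export mpoly.
From Stdlib Require Import Relations.

Set Implicit Arguments.
Unset Strict Implicit.
Unset Printing Implicit Defensive.

Import GRing.Theory.
Local Open Scope ring_scope.
Local Open Scope quotient_scope.

(* The library's [idealr] only covers proper ideals; here the unit ideal is
   allowed, so that the quotient may be the zero ring. *)
HB.mixin Record isAbsorbing (A : comNzRingType) (J : A -> bool) := {
  absorbing_subproof : forall a : A, {in J, forall u, a * u \in J}
}.

#[short(type="ideal")]
HB.structure Definition Ideal (A : comNzRingType) :=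
  {J of GRing.ZmodClosed A J & isAbsorbing A J}.

Section QuotientRing.
Variables (A : comNzRingType) (J : ideal A).

Definition quotient_ring : Type := {ideal_quot J}.
HB.instance Definition _ := GRing.Zmodule.on quotient_ring.

Definition residue (a : A) : quotient_ring := \pi_{ideal_quot J} a.

Lemma residue_eq a b : (residue a == residue b) = (a - b \in J).
Proof. by rewrite Quotient.idealrBE. Qed.

Lemma residue_repr (x : quotient_ring) : residue (repr x) = x.
Proof. exact: reprK. Qed.

Lemma residue_is_zmod_morphism : zmod_morphism residue.
Proof. by move=> a b; rewrite /residue !piE. Qed.
HB.instance Definition _ :=
  GRing.isZmodMorphism.Build A quotient_ring residue residue_is_zmod_morphism.

Definition quotient_one : quotient_ring := residue 1.
Definition quotient_mul (x y : quotient_ring) : quotient_ring :=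
  residue (repr x * repr y).

Lemma residue_mul a b : quotient_mul (residue a) (residue b) = residue (a * b).
Proof.
apply/eqP; rewrite residue_eq.
have absorb (c u : A) : u \in J -> c * u \in J by exact: absorbing_subproof.
have Ja (c : A) : repr (residue c) - c \in J by rewrite -residue_eq residue_repr.
set a' := repr _; set b' := repr _.
have -> : a' * b' - a * b = a' * (b' - b) + b * (a' - a).
  by rewrite !mulrBr addrA (mulrC b a') addrNK (mulrC b a).
by rewrite rpredD ?absorb ?Ja.
Qed.

Lemma quotient_mulA : associative quotient_mul.
Proof.
move=> x y z; rewrite -(residue_repr x) -(residue_repr y) -(residue_repr z).
by rewrite !residue_mul mulrA.
Qed.

Lemma quotient_mulC : commutative quotient_mul.
Proof. by move=> x y; rewrite /quotient_mul mulrC. Qed.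

Lemma quotient_mul1 : left_id quotient_one quotient_mul.
Proof. by move=> x; rewrite -(residue_repr x) residue_mul mul1r. Qed.

Lemma quotient_mulDl : left_distributive quotient_mul +%R.
Proof.
move=> x y z; rewrite -(residue_repr x) -(residue_repr y) -(residue_repr z).
by rewrite -raddfD !residue_mul mulrDl raddfD.
Qed.

HB.instance Definition _ := GRing.Zmodule_isComPzRing.Build quotient_ring
  quotient_mulA quotient_mulC quotient_mul1 quotient_mulDl.

Lemma residue_is_monoid_morphism : monoid_morphism residue.
Proof. by split=> // a b; rewrite -residue_mul. Qed.
HB.instance Definition _ := GRing.isMonoidMorphism.Build A quotient_ring residue
  residue_is_monoid_morphism.

End QuotientRing.

Arguments residue {A} J a.

Section FinitelyGenerated.
Variable A : comPzRingType.

Definition ideal_generated (gs : seq A) (a : A) : Prop :=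
  exists c : 'I_(size gs) -> A, a = \sum_(i < size gs) c i * gs`_i.

Definition generates (gs : seq A) (I : A -> Prop) : Prop :=
  forall a, I a <-> ideal_generated gs a.

End FinitelyGenerated.

Section AffineAlgebra.
Variables (K : fieldType) (n : nat) (J : ideal {mpoly K[n]}).

Definition affine_algebra : Type := quotient_ring J.
HB.instance Definition _ := GRing.ComPzRing.on affine_algebra.

Definition affine_scale (c : K) (x : affine_algebra) : affine_algebra :=
  residue J c%:MP * x.

Lemma affine_scaleA c d x :
  affine_scale c (affine_scale d x) = affine_scale (c * d) x.
Proof. by rewrite /affine_scale mulrA -rmorphM -mpolyCM. Qed.

Lemma affine_scale1 : left_id 1 affine_scale.
Proof. by move=> x; rewrite /affine_scale mpolyC1 rmorph1 mul1r. Qed.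

Lemma affine_scaleDr : right_distributive affine_scale +%R.
Proof. by move=> c x y; rewrite /affine_scale mulrDr. Qed.

Lemma affine_scaleDl x : {morph affine_scale^~ x : c d / c + d}.
Proof. by move=> c d; rewrite /affine_scale mpolyCD rmorphD mulrDl. Qed.

HB.instance Definition _ := GRing.Zmodule_isLmodule.Build K affine_algebra
  affine_scaleA affine_scale1 affine_scaleDr affine_scaleDl.

(* The same closure conditions as [subalg_closed], which the library only
   states over nonzero rings. *)
Definition is_subalgebra (B : affine_algebra -> Prop) : Prop :=
  [/\ B 1,
      forall (c : K) x y, B x -> B y -> B (c *: x + y)
    & forall x y, B x -> B y -> B (x * y)].

Definition subalgebra_generated (X : affine_algebra -> Prop)
    (a : affine_algebra) : Prop :=
  forall B : affine_algebra -> Prop,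
    is_subalgebra B -> (forall x, X x -> B x) -> B a.

Variables (r : nat) (le_rn : (r <= n)%N).

Definition generator_class (i : 'I_r) : affine_algebra :=
  residue J 'X_(widen_ord le_rn i).

Definition S_hat : affine_algebra -> Prop :=
  subalgebra_generated (fun x => exists i : 'I_r, x = generator_class i).

Definition S_set (a : affine_algebra) : Prop := S_hat a /\ a <> 0.

(* The variables of [{mpoly K[r]}] play the role of t_1, ..., t_r. *)
Definition phi (p : {mpoly K[r]}) : affine_algebra :=
  residue J (p \mPo [tuple 'X_(widen_ord le_rn i) | i < r]).

Lemma phi_is_zmod_morphism : zmod_morphism phi.
Proof. by move=> p q; rewrite /phi raddfB [LHS]raddfB. Qed.
HB.instance Definition _ := GRing.isZmodMorphism.Build {mpoly K[r]}
  affine_algebra phi phi_is_zmod_morphism.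

Lemma phi_is_monoid_morphism : monoid_morphism phi.
Proof.
split=> [|p q]; first by rewrite /phi comp_mpoly1.
rewrite /phi -[RHS](residue_is_monoid_morphism J).2; congr (residue J _).
exact: (rmorphM (comp_mpoly _)).
Qed.
HB.instance Definition _ := GRing.isMonoidMorphism.Build {mpoly K[r]}
  affine_algebra phi phi_is_monoid_morphism.

Lemma phi_is_scalable : scalable phi.
Proof.
by move=> c p; rewrite /phi comp_mpolyZ -mul_mpolyC;
  exact: (residue_is_monoid_morphism J).2.
Qed.
HB.instance Definition _ := GRing.isScalable.Build K {mpoly K[r]}
  affine_algebra *:%R phi phi_is_scalable.

Lemma phi_X i : phi 'X_i = generator_class i.
Proof. by rewrite /phi comp_mpolyXU -tnth_nth tnth_mktuple. Qed.

(* Configurations of the algorithm.  [Scan ws] holds the generators w_i that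
   have not been tested yet, in order. *)
Inductive config :=
  | Input of seq affine_algebra
  | Scan of seq {mpoly K[r]}
  | Return of affine_algebra.

(* The method used for computing generators of the preimage is left open:
   [step_preimage] may produce any finite generating list, so a statement about
   all runs covers every correct subroutine, and an input for which no such list
   exists would be stuck. *)
Inductive step : config -> config -> Prop :=
  | step_preimage gs ws :
      generates ws (fun p => ideal_generated gs (phi p)) ->
      step (Input gs) (Scan ws)
  | step_found w ws : phi w != 0 -> step (Scan (w :: ws)) (Return (phi w))
  | step_next w ws : phi w == 0 -> step (Scan (w :: ws)) (Scan ws)
  | step_exhausted : step (Scan [::]) (Return 0).

Definition returned (s : config) : Prop := exists a, s = Return a.

(* Every run is finite and ends in a [Return] configuration. *)
Inductive terminates (s : config) : Prop :=
  Terminates of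
    returned s \/ (exists s', step s s') & forall s', step s s' -> terminates s'.

Definition outputs (gs : seq affine_algebra) (a : affine_algebra) : Prop :=
  clos_refl_trans config step (Input gs) (Return a).

End AffineAlgebra.

(* Main.v *)
Require Import Defs.
From mathcomp Require Import all_boot all_order all_algebra.
From Stdlib Require Import Relations Classical.
Set Implicit Arguments.
Unset Strict Implicit.
Unset Printing Implicit Defensive.
Import Order.TTheory GRing.Theory.
Local Open Scope ring_scope.

(** Write [phi] for the homomorphism from K[t_1, ..., t_r] to R.

    Correctness.  The image of [phi] is exactly [S_hat]: it is a subalgebra
    containing the generators ([S_hat_phi]), and every polynomial expression in
    the generators lies in every such subalgebra ([phi_S_hat]).  Hence the
    elements of I that lie in [S_hat] are the values of [phi] on the preimage of
    I.  If I meets S, some p in the preimage has [phi p != 0]; as the kernel of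
    [phi] is an ideal, it cannot contain all the generators w_i of the preimage,
    so the scan finds some [phi w_i != 0], an element of I and of S.  Conversely
    any nonzero value that the scan finds shows that I meets S.

    Termination.  The scan shortens its list at every step, so the only issue is
    whether the preimage has a finite generating list at all.  This is Hilbert's
    basis theorem ([hilbert_basis]), derived here from Dickson's lemma
    ([dickson]) by division: choose finitely many nonzero members of the ideal
    whose leading monomials divide all leading monomials of the ideal, and cancel
    the leading terms of any other member against them until nothing is left. *)

(** * Ideals *)

Section Ideals.
Variable A : comPzRingType.
Implicit Types (I : A -> Prop) (gs : seq A).

(** A Prop-valued notion over a possibly zero ring: membership in
    [ideal_generated gs] comes without a boolean test, and R may be zero. *)
Definition is_ideal I : Prop :=
  [/\ I 0, forall a b, I a -> I b -> I (a + b) & forall c a, I a -> I (c * a)].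

Lemma ideal_generated_is_ideal gs : is_ideal (ideal_generated gs).
Proof.
split=> [|a b [c ->] [d ->]|e a [c ->]].
- by exists (fun=> 0); rewrite big1 // => i _; rewrite mul0r.
- by exists (fun i => c i + d i); rewrite -big_split; apply: eq_bigr => i _;
    rewrite mulrDl.
- by exists (fun i => e * c i); rewrite mulr_sumr; apply: eq_bigr => i _;
    rewrite mulrA.
Qed.

Lemma mem_ideal_generated gs g : g \in gs -> ideal_generated gs g.
Proof.
move=> g_gs; have lt_gs : (index g gs < size gs)%N by rewrite index_mem.
exists (fun i => (i == Ordinal lt_gs)%:R).
rewrite (bigD1 (Ordinal lt_gs)) //= eqxx mul1r nth_index // big1 ?addr0 //.
by move=> i /negbTE ->; rewrite mul0r.
Qed.

Lemma ideal_generated_min gs I :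
  is_ideal I -> {in gs, forall g, I g} -> forall a, ideal_generated gs a -> I a.
Proof.
move=> [I0 ID IM] gsI a [c ->]; apply: (big_ind I) => // i _.
by apply/IM/gsI/mem_nth.
Qed.

End Ideals.

Lemma is_ideal_preim (A B : comPzRingType) (f : {rmorphism A -> B})
    (I : B -> Prop) :
  is_ideal I -> is_ideal (fun a => I (f a)).
Proof.
move=> [I0 ID IM]; split=> [|a b Ia Ib|c a Ia]; first by rewrite rmorph0.
  by rewrite rmorphD; apply: ID.
by rewrite rmorphM; apply: IM.
Qed.

(** * Dickson's lemma *)

(** For a bound N on the new coordinate, the part of P where that coordinate is
    below N splits into N slices, on each of which domination in the other
    coordinates suffices. *)
Lemma dickson_slices (T : eqType) (X : Type) (c : X -> T -> nat) (j : X)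
    (dom : T -> T -> Prop) (P : T -> Prop) :
  (forall Q : T -> Prop, exists s : seq T,
     {in s, forall y, Q y} /\
     forall x, Q x -> exists2 y, y \in s & dom y x) ->
  forall N, exists s : seq T,
    {in s, forall y, P y} /\
    forall x, P x -> (c j x < N)%N ->
      exists2 y, y \in s & dom y x /\ (c j y <= c j x)%N.
Proof.
move=> basis; elim=> [|N [s [sP s_dom]]]; first by exists [::].
have [t [tP t_dom]] := basis (fun x => P x /\ c j x = N).
exists (s ++ t); split=> [y|x Px].
  by rewrite mem_cat => /orP[/sP//|/tP[]].
rewrite ltnS leq_eqVlt => /orP[/eqP cx|/(s_dom _ Px)[y ys ydom]]; last first.
  by exists y; rewrite ?mem_cat ?ys.
have [y yt ydom] := t_dom x (conj Px cx).
by exists y; rewrite ?mem_cat ?yt ?orbT // (tP y yt).2 cx.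
Qed.

(** The points of P are compared through arbitrary coordinate functions instead
    of being vectors, so that the induction can treat one coordinate at a time
    without changing the ambient type, and so that the witnesses are the points
    themselves.  For the new coordinate j, a basis s for the others handles
    every x with [c j x] at least the maximum of [c j] on s; below this maximum
    there are finitely many slices. *)
Lemma dickson (T X : eqType) (c : X -> T -> nat) (js : seq X)
    (P : T -> Prop) :
  exists s : seq T, {in s, forall y, P y} /\
    forall x, P x ->
      exists2 y, y \in s & {in js, forall j, (c j y <= c j x)%N}.
Proof.
elim: js P => [|j js IHjs] P.
  have [[x Px]|noP] := classic (exists x, P x).
    exists [:: x]; split=> [y|y _]; first by rewrite inE => /eqP ->.
    by exists x; rewrite ?inE.
  by exists [::]; split=> // x Px; case: noP; exists x.
have [s [sP s_dom]] := IHjs P.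
pose N := (\max_(y <- s) c j y)%N.
have [t [tP t_dom]] := dickson_slices c j P IHjs N.
exists (s ++ t); split=> [y|x Px].
  by rewrite mem_cat => /orP[/sP|/tP].
have [lt_xN|le_Nx] := ltnP (c j x) N.
  have [y yt [ydom yj]] := t_dom x Px lt_xN.
  exists y; first by rewrite mem_cat yt orbT.
  by move=> k; rewrite inE => /predU1P[->|/ydom].
have [y ys ydom] := s_dom x Px.
exists y; first by rewrite mem_cat ys.
move=> k; rewrite inE => /predU1P[->|/ydom//].
by apply: leq_trans le_Nx; rewrite /N; apply: leq_bigmax_seq.
Qed.

(** * Hilbert's basis theorem *)

Section HilbertBasis.
Variables (K : fieldType) (r : nat).
Implicit Types p q : {mpoly K[r]}.

(** Equal leading terms cancel. *)
Lemma mlead_sub_lt p q :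
  mlead q = mlead p -> mleadc q = mleadc p -> p - q != 0 ->
  (mlead (p - q) < mlead p)%O.
Proof.
move=> eq_m eq_c nz; rewrite lt_neqAle.
apply/andP; split; last first.
  by have := mleadB_le p q; rewrite eq_m joinxx.
apply: contra nz => /eqP eq_lead.
by rewrite -mleadc_eq0 eq_lead mcoeffB -{2}eq_m eq_c subrr.
Qed.

(** Multiply q by the quotient of the leading terms. *)
Lemma exists_multiple_same_lead p q :
  p != 0 -> q != 0 -> (mlead q <= mlead p)%MM ->
  exists h, mlead (h * q) = mlead p /\ mleadc (h * q) = mleadc p.
Proof.
move=> p0 q0 le_qp; pose a := mleadc p / mleadc q.
have [cp0 cq0] : mleadc p != 0 /\ mleadc q != 0 by rewrite !mleadc_eq0.
have a0 : a != 0 by rewrite mulf_neq0 ?invr_eq0.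
have X0 : 'X_[mlead p - mlead q] != 0 :> {mpoly K[r]}.
  by rewrite -mleadc_eq0 mleadXm mcoeffX eqxx oner_eq0.
exists (a *: 'X_[mlead p - mlead q]).
split; first by rewrite -scalerAl mleadZ // mleadM // mleadXm submK.
rewrite -scalerAl mleadcZE mleadcM_proper mleadXm mcoeffX eqxx mul1r //.
by rewrite divfK.
Qed.

(** A step of the division algorithm strictly lowers the leading monomial as
    long as the remainder is nonzero, and monomial orders are well founded. *)
Lemma generated_by_lead_basis (I : {mpoly K[r]} -> Prop)
    (ws : seq {mpoly K[r]}) :
  is_ideal I -> {in ws, forall w, I w /\ w != 0} ->
  (forall p, I p -> p != 0 -> exists2 w, w \in ws & (mlead w <= mlead p)%MM) ->
  generates ws I.
Proof.
move=> I_ideal wsI lead_dom p; have [I0 ID IM] := I_ideal.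
have [G0 GD GM] := ideal_generated_is_ideal ws.
split; last by apply: ideal_generated_min => // w /wsI[].
elim/mleadrect: p => p IHp Ip.
have [->//|p0] := eqVneq p 0.
have [w w_ws le_wp] := lead_dom p Ip p0; have [Iw w0] := wsI w w_ws.
have [h [eq_m eq_c]] := exists_multiple_same_lead p0 w0 le_wp.
have Ghw : ideal_generated ws (h * w) by apply/GM/mem_ideal_generated.
have [/eqP|nz] := eqVneq (p - h * w) 0; first by rewrite subr_eq0 => /eqP ->.
rewrite -[p](subrK (h * w)); apply: GD => //; apply: IHp.
  exact: mlead_sub_lt.
by apply: ID => //; rewrite -mulNr; apply: IM.
Qed.

(** Dickson's lemma is applied to the polynomials themselves, through the
    exponents of their leading monomials, so that it selects members of I. *)
Lemma hilbert_basis (I : {mpoly K[r]} -> Prop) :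
  is_ideal I -> exists ws, generates ws I.
Proof.
move=> I_ideal.
have [ws [wsI dom]] := dickson (fun (i : 'I_r) p => mlead p i) (enum 'I_r)
  (fun p => I p /\ p != 0).
exists ws; apply: generated_by_lead_basis => // p Ip p0.
have [w w_ws le_wp] := dom p (conj Ip p0).
by exists w => //; apply/mnm_lepP => i; apply: le_wp; rewrite mem_enum.
Qed.

End HilbertBasis.

(** * The image of phi *)

Section Image.
Variables (K : fieldType) (n : nat) (J : ideal {mpoly K[n]}).
Variables (r : nat) (le_rn : (r <= n)%N).
Notation phi := (@phi K n J r le_rn).

Lemma phi_S_hat p : S_hat le_rn (phi p).
Proof.
move=> B [B1 BL BM] Bgen.
(* The closure conditions do not list 0, but -1 *: 1 + 1 is in B. *)
have B0 : B 0 by rewrite -(addNr 1) -scaleN1r; apply: BL.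
have BX k x : B x -> B (x ^+ k).
  by move=> Bx; elim: k => [|k IHk]; rewrite ?expr0 ?exprS //; apply: BM.
rewrite [p]mpolyE raddf_sum; apply: (big_ind B) => //.
  by move=> x y Bx By; rewrite -[x]scale1r; apply: BL.
move=> m _; rewrite /= linearZ -[X in B X]addr0; apply: BL => //=.
rewrite mpolyXE_id rmorph_prod; apply: (big_ind B) => // i _.
by rewrite rmorphXn /= phi_X; apply/BX/Bgen; exists i.
Qed.

Lemma S_hat_phi a : S_hat le_rn a -> exists p, a = phi p.
Proof.
move/(_ (fun b => exists p, b = phi p)); apply=> [|_ [i ->]]; last first.
  by exists 'X_i; rewrite phi_X.
split; first by exists 1; rewrite rmorph1.
- by move=> c _ _ [p ->] [q ->]; exists (c *: p + q); rewrite linearP.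
- by move=> _ _ [p ->] [q ->]; exists (p * q); rewrite rmorphM.
Qed.

(** * Runs of the algorithm *)

Lemma terminates_return (a : affine_algebra J) : terminates le_rn (Return r a).
Proof. by split=> [|s' st]; [left; exists a | inversion st]. Qed.

Lemma terminates_scan ws : terminates le_rn (Scan J ws).
Proof.
elim: ws => [|w ws IHws].
  split=> [|s' st]; first by right; exists (Return r 0); constructor.
  by inversion st; apply: terminates_return.
split=> [|s' st]; last first.
  by inversion st; [apply: terminates_return | apply: IHws].
right; have [w0|w0] := boolP (phi w == 0).
  by exists (Scan J ws); apply: step_next.
by exists (Return r (phi w)); apply: step_found.
Qed.

Lemma scan_result ws a :
  clos_refl_trans _ (@step K n J r le_rn) (Scan J ws) (Return r a) ->
  (exists w, [/\ w \in ws, a = phi w & a <> 0]) \/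
  (a = 0 /\ {in ws, forall w, phi w = 0}).
Proof.
have return_eq b : clos_refl_trans_1n _ (@step K n J r le_rn)
    (Return r b) (Return r a) -> a = b.
  by move=> run; inversion run as [|? ? st]; last by inversion st.
move/clos_rt_rt1n_iff; elim: ws => [|w ws IHws] run.
  right; inversion run as [|? ? st run']; subst.
  by inversion st; subst; split; first exact: return_eq.
inversion run as [|? ? st run']; subst; inversion st as [|? ? w0|? ? w0|]; subst.
  left; exists w; rewrite mem_head (return_eq _ run').
  by split=> //; apply/eqP.
case: (IHws run') => [[v [v_ws -> nz]]|[-> ws0]]; [left|right].
  by exists v; rewrite inE v_ws orbT.
by split=> // v; rewrite inE => /predU1P[->|/ws0//]; apply/eqP.
Qed.

End Image.

Theorem proposition17 (K : fieldType) (n : nat) (J : ideal {mpoly K[n]})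
    (I : affine_algebra J -> Prop) (gs : seq (affine_algebra J))
    (gsI : generates gs I)
    (r : nat) (r_gt0 : (0 < r)%N) (le_rn : (r <= n)%N) :
  terminates le_rn (Input r gs) /\
  forall a : affine_algebra J, outputs le_rn gs a ->
    ((exists s, I s /\ S_set le_rn s) -> I a /\ S_set le_rn a) /\
    (~ (exists s, I s /\ S_set le_rn s) -> a = 0).
Proof.
split.
  split=> [|s' st]; last by inversion st; apply: terminates_scan.
  have [ws gen_ws] := hilbert_basis
    (is_ideal_preim (phi J le_rn) (ideal_generated_is_ideal gs)).
  by right; exists (Scan J ws); apply: step_preimage.
move=> a /clos_rt_rt1n_iff run.
inversion run as [|? ? st run']; subst; inversion st as [? ws gen_ws| | |]; subst.
move/clos_rt_rt1n_iff/scan_result: run'.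
case=> [[w [w_ws eq_a a0]]|[-> ws0]].
  have Sa : I a /\ S_set le_rn a.
    split; first by rewrite eq_a; apply/gsI/gen_ws/mem_ideal_generated.
    by split=> //; rewrite eq_a; apply: phi_S_hat.
  by split=> // noS; case: noS; exists a.
split=> // -[s [Is [/S_hat_phi[p eq_s] s0]]]; case: s0.
have zero_ideal : is_ideal (fun x : affine_algebra J => x = 0).
  by split=> // [x y -> ->|c x ->]; rewrite ?addr0 ?mulr0.
(* The kernel of phi contains the generators w_i, hence the whole preimage. *)
have ker_ideal := is_ideal_preim (phi J le_rn) zero_ideal.
rewrite eq_s; apply: (ideal_generated_min ker_ideal ws0).
by apply/gen_ws/gsI; rewrite -eq_s.
Qed.
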